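(* Let $\mathcal U$ be a structurally complete variety of closure algebras and $\mathcal W$ a non-minimal variety of monadic algebras. Then the varietal join $\mathcal V=\mathcal U\vee\mathcal W$ is almost structurally complete but not structurally complete.
   Context: A closure algebra is a Boolean algebra with unary $\Diamond$ satisfying $\Diamond0=0$, $\Diamond(a\vee b)=\Diamond a\vee\Diamond b$, $a\le\Diamond a=\Diamond\Diamond a$; $\Box x=\neg\Diamond\neg x$; it is monadic if $\Diamond\Box a=\Box a$ for all $a$. A variety is minimal if it properly contains only the trivial variety. For a variety $\mathcal V$ with free algebra $\mathbf F$ of countably infinite rank: $\mathcal V$ is structurally complete if every quasi-identity true in $\mathbf F$ holds in $\mathcal V$. For a quasi-identity $q=(\forall\bar x)[\varphi(\bar x)\to\psi(\bar x)]$ ($\varphi$ a finite conjunction of equations, $\psi$ an equation) let $q^*=(\forall\bar x)\neg\varphi(\bar x)$; $q$ true in $\mathbf F$ is active if $q^*$ fails in $\mathbf F$; $\mathcal V$ is almost structurally complete if every active quasi-identity holds in $\mathcal V$. *)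

(* Defs.v *)
From HB Require Import structures.
From mathcomp Require Import all_boot all_order.
From mathcomp Require Import generic_quotient boolp.

Set Implicit Arguments.
Unset Strict Implicit.
Unset Printing Implicit Defensive.

Import Order.Theory.
Local Open Scope order_scope.

(* All closure algebras share one display (a printing tag), so that a class of *)
(* algebras is a predicate on a single type.  Boolean algebras are MathComp's  *)
(* complemented distributive lattices; \bot = \top is allowed.                 *)
Fact ca_display : Order.disp_t. Proof. exact: (Order.Disp tt tt). Qed.

HB.mixin Record isClosureAlgebra T of Order.CTBDistrLattice ca_display T := {
  diamond : T -> T;
  diamond0 : diamond \bot = \bot;
  diamondU : forall a b, diamond (a `|` b) = diamond a `|` diamond b;
  diamond_ge : forall a, a <= diamond a;
  diamondK : forall a, diamond (diamond a) = diamond a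
}.

#[short(type="closureAlgType")]
HB.structure Definition ClosureAlgebra :=
  { T of Order.CTBDistrLattice ca_display T & isClosureAlgebra T }.

Definition box (A : closureAlgType) (a : A) : A := ~` diamond (~` a).

Definition monadic (A : closureAlgType) : Prop :=
  forall a : A, diamond (box a) = box a.

Inductive term : Type :=
| TVar of nat
| TBot
| TTop
| TMeet of term & term
| TJoin of term & term
| TNeg of term
| TDia of term.

Fixpoint eval (A : closureAlgType) (v : nat -> A) (t : term) : A :=
  match t with
  | TVar n => v n
  | TBot => \bot
  | TTop => \top
  | TMeet s u => eval v s `&` eval v u
  | TJoin s u => eval v s `|` eval v u
  | TNeg s => ~` eval v s
  | TDia s => diamond (eval v s)
  end.

Definition equation : Type := (term * term)%type.

Definition sat_eq (A : closureAlgType) (v : nat -> A) (e : equation) : Prop :=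
  eval v e.1 = eval v e.2.

Definition true_eq (A : closureAlgType) (e : equation) : Prop :=
  forall v : nat -> A, sat_eq v e.

(* The finite conjunction of equations is given by the list of its conjuncts;  *)
(* the empty list is the true premise.                                         *)
Record quasi_identity := QuasiIdentity {
  premise : seq equation;
  conclusion : equation
}.

Fixpoint sat_conj (A : closureAlgType) (v : nat -> A) (phi : seq equation)
    : Prop :=
  if phi is e :: phi' then sat_eq v e /\ sat_conj v phi' else True.

Definition true_qid (A : closureAlgType) (q : quasi_identity) : Prop :=
  forall v : nat -> A, sat_conj v (premise q) -> sat_eq v (conclusion q).

(* q^* = (forall x) not premise(x) *)
Definition true_star (A : closureAlgType) (q : quasi_identity) : Prop :=
  forall v : nat -> A, ~ sat_conj v (premise q).

Definition algebra_class : Type := closureAlgType -> Prop.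

Definition subclass (K L : algebra_class) : Prop := forall A, K A -> L A.

Definition class_eq (K L : algebra_class) : Prop := forall A, K A <-> L A.

Definition proper_subclass (K L : algebra_class) : Prop :=
  subclass K L /\ ~ subclass L K.

(* A variety is the class of all models of some set of identities. *)
Definition is_variety (V : algebra_class) : Prop :=
  exists E : equation -> Prop,
    forall A, V A <-> (forall e, E e -> true_eq A e).

Definition trivial_variety : algebra_class :=
  fun A => forall x y : A, x = y.

(* The trivial variety itself is minimal in this sense, vacuously; hence a     *)
(* non-minimal variety is a nontrivial one with a nontrivial proper subvariety. *)
Definition minimal_variety (V : algebra_class) : Prop :=
  forall V', is_variety V' -> proper_subclass V' V ->
    class_eq V' trivial_variety.

Definition varietal_join (U W : algebra_class) : algebra_class :=
  fun A => forall V', is_variety V' -> subclass U V' -> subclass W V' -> V' A.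

HB.instance Definition _ := gen_eqMixin term.
HB.instance Definition _ := gen_choiceMixin term.

Section FreeAlgebra.
Variable V : algebra_class.

Definition free_rel (s t : term) : bool :=
  `[< forall A : closureAlgType, V A -> true_eq A (s, t) >].

Lemma free_rel_refl : reflexive free_rel.
Proof. by move=> s; apply/asboolP => A _ v. Qed.

Lemma free_rel_sym : symmetric free_rel.
Proof.
by move=> s t; apply/asboolP/asboolP => H A VA v; apply/esym; apply: H.
Qed.

Lemma free_rel_trans : transitive free_rel.
Proof.
move=> t s u /asboolP H1 /asboolP H2; apply/asboolP => A VA v.
by rewrite /sat_eq /= (H1 A VA v); apply: (H2 A VA v).
Qed.

Definition free_equiv : equiv_rel term :=
  EquivRel free_rel free_rel_refl free_rel_sym free_rel_trans.

(* The free algebra of V on generators indexed by nat: terms modulo the        *)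
(* identities true in all members of V.  It is a closure algebra for any class *)
(* V, and lies in V when V is a variety: see free_alg_mem and                  *)
(* free_alg_universal.                                                         *)
Definition free_alg : Type := {eq_quot free_equiv}%qT.

HB.instance Definition _ := Choice.on free_alg.
HB.instance Definition _ := Quotient.on free_alg.

Definition fpi (t : term) : free_alg := (\pi_free_alg t)%qT.
Definition frepr (x : free_alg) : term := repr x.

Lemma freprK x : fpi (frepr x) = x.
Proof. exact: reprK. Qed.

Lemma fpiP s t :
  (fpi s = fpi t) <-> (forall A : closureAlgType, V A -> true_eq A (s, t)).
Proof.
split=> [H|H].
- apply/asboolP; rewrite -/(free_rel s t) -[free_rel s t]/(free_equiv s t).
  by apply/eqmodP.
- by apply/eqmodP; apply/asboolP.
Qed.

Lemma frepr_eval (A : closureAlgType) (v : nat -> A) t :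
  V A -> eval v (frepr (fpi t)) = eval v t.
Proof. by move=> VA; apply: ((fpiP (frepr (fpi t)) t).1 (freprK _) A VA v). Qed.

Definition fmeet (x y : free_alg) := fpi (TMeet (frepr x) (frepr y)).
Definition fjoin (x y : free_alg) := fpi (TJoin (frepr x) (frepr y)).
Definition fneg (x : free_alg) := fpi (TNeg (frepr x)).
Definition fdia (x : free_alg) := fpi (TDia (frepr x)).
Definition fle (x y : free_alg) : bool := fmeet x y == x.
Definition flt (x y : free_alg) : bool := (y != x) && fle x y.

Lemma fmeetE s t : fmeet (fpi s) (fpi t) = fpi (TMeet s t).
Proof. by apply/fpiP => A VA v; rewrite /sat_eq /= !frepr_eval. Qed.
Lemma fjoinE s t : fjoin (fpi s) (fpi t) = fpi (TJoin s t).
Proof. by apply/fpiP => A VA v; rewrite /sat_eq /= !frepr_eval. Qed.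
Lemma fnegE s : fneg (fpi s) = fpi (TNeg s).
Proof. by apply/fpiP => A VA v; rewrite /sat_eq /= !frepr_eval. Qed.
Lemma fdiaE s : fdia (fpi s) = fpi (TDia s).
Proof. by apply/fpiP => A VA v; rewrite /sat_eq /= !frepr_eval. Qed.

Lemma free_ind (P : free_alg -> Prop) : (forall t, P (fpi t)) -> forall x, P x.
Proof. by move=> H x; rewrite -(freprK x). Qed.

Definition fopE := (fmeetE, fjoinE, fnegE, fdiaE).

Fact fmeetC : commutative fmeet.
Proof.
by elim/free_ind => s; elim/free_ind => t; rewrite !fopE; apply/fpiP => A VA v;
  apply: meetC.
Qed.
Fact fjoinC : commutative fjoin.
Proof.
by elim/free_ind => s; elim/free_ind => t; rewrite !fopE; apply/fpiP => A VA v;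
  apply: joinC.
Qed.
Fact fmeetA : associative fmeet.
Proof.
by elim/free_ind => s; elim/free_ind => t; elim/free_ind => u; rewrite !fopE;
  apply/fpiP => A VA v; apply: meetA.
Qed.
Fact fjoinA : associative fjoin.
Proof.
by elim/free_ind => s; elim/free_ind => t; elim/free_ind => u; rewrite !fopE;
  apply/fpiP => A VA v; apply: joinA.
Qed.
Fact fjoinKI (y x : free_alg) : fmeet x (fjoin x y) = x.
Proof.
by elim/free_ind: x => s; elim/free_ind: y => t; rewrite !fopE;
  apply/fpiP => A VA v; apply: joinKI.
Qed.
Fact fmeetKU (y x : free_alg) : fjoin x (fmeet x y) = x.
Proof.
by elim/free_ind: x => s; elim/free_ind: y => t; rewrite !fopE;
  apply/fpiP => A VA v; apply: meetKU.
Qed.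
Fact fmeetUl : left_distributive fmeet fjoin.
Proof.
by elim/free_ind => s; elim/free_ind => t; elim/free_ind => u; rewrite !fopE;
  apply/fpiP => A VA v; apply: meetUl.
Qed.
Fact fmeetxx : idempotent_op fmeet.
Proof.
by elim/free_ind => s; rewrite !fopE; apply/fpiP => A VA v; apply: meetxx.
Qed.
Fact fle_def x y : fle x y = (fmeet x y == x). Proof. by []. Qed.
Fact flt_def x y : flt x y = (y != x) && fle x y. Proof. by []. Qed.

HB.instance Definition _ := @Order.isMeetJoinDistrLattice.Build
  ca_display free_alg fle flt fmeet fjoin fle_def flt_def fmeetC fjoinC
  fmeetA fjoinA fjoinKI fmeetKU fmeetUl fmeetxx.

Fact fle0x (x : free_alg) : fpi TBot <= x.
Proof.
elim/free_ind: x => s; apply/eqP; rewrite fopE; apply/fpiP => A VA v.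
exact: meet0x.
Qed.
Fact flex1 (x : free_alg) : x <= fpi TTop.
Proof.
elim/free_ind: x => s; apply/eqP; rewrite fopE; apply/fpiP => A VA v.
exact: meetx1.
Qed.

HB.instance Definition _ := @Order.hasBottom.Build ca_display free_alg _ fle0x.
HB.instance Definition _ := @Order.hasTop.Build ca_display free_alg _ flex1.

Fact fjoinxC (x : free_alg) : x `|` fneg x = \top.
Proof.
elim/free_ind: x => s; rewrite -[LHS]/(fjoin _ _) !fopE.
by apply/fpiP => A VA v; apply: joinxC.
Qed.
Fact fmeetxC (x : free_alg) : x `&` fneg x = \bot.
Proof.
elim/free_ind: x => s; rewrite -[LHS]/(fmeet _ _) !fopE.
by apply/fpiP => A VA v; apply: meetxC.
Qed.

HB.instance Definition _ := @Order.TBDistrLattice_hasComplement.Build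
  ca_display free_alg fneg fjoinxC fmeetxC.

Fact fdia0 : fdia \bot = \bot.
Proof.
by rewrite -[\bot]/(fpi TBot) fopE; apply/fpiP => A VA v; apply: diamond0.
Qed.
Fact fdiaU (x y : free_alg) : fdia (x `|` y) = fdia x `|` fdia y.
Proof.
elim/free_ind: x => s; elim/free_ind: y => t.
rewrite -[RHS]/(fjoin _ _) -[_ `|` _]/(fjoin _ _) !fopE.
by apply/fpiP => A VA v; apply: diamondU.
Qed.
Fact fdia_ge (x : free_alg) : x <= fdia x.
Proof.
elim/free_ind: x => s; apply/eqP; rewrite !fopE; apply/fpiP => A VA v.
by apply/meet_idPl; apply: diamond_ge.
Qed.
Fact fdiaK (x : free_alg) : fdia (fdia x) = fdia x.
Proof.
by elim/free_ind: x => s; rewrite !fopE; apply/fpiP => A VA v; apply: diamondK.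
Qed.

HB.instance Definition _ :=
  isClosureAlgebra.Build free_alg fdia0 fdiaU fdia_ge fdiaK.

Definition free_gen (n : nat) : free_alg := fpi (TVar n).

End FreeAlgebra.

Definition structurally_complete (V : algebra_class) : Prop :=
  forall q, true_qid (free_alg V) q -> forall A, V A -> true_qid A q.

Definition active (V : algebra_class) (q : quasi_identity) : Prop :=
  true_qid (free_alg V) q /\ ~ true_star (free_alg V) q.

Definition almost_structurally_complete (V : algebra_class) : Prop :=
  forall q, active V q -> forall A, V A -> true_qid A q.

Lemma varietal_join_variety U W : is_variety (varietal_join U W).
Proof.
exists (fun e => (forall A, U A -> true_eq A e) /\
                 (forall A, W A -> true_eq A e)) => A; split.
- move=> JA; apply: (JA (fun B => forall e,
    (forall A, U A -> true_eq A e) /\ (forall A, W A -> true_eq A e) ->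
    true_eq B e)); first by eexists=> B; exact: iff_refl.
  + by move=> B UB e [+ _]; apply.
  + by move=> B WB e [_]; apply.
- move=> H V' [E VE] UV WV; apply/VE => e Ee; apply: H.
  by split=> B => [/UV|/WV] /VE; apply.
Qed.

Lemma varietal_join_subl U W : subclass U (varietal_join U W).
Proof. by move=> A UA V' _ + _; apply. Qed.

Lemma varietal_join_subr U W : subclass W (varietal_join U W).
Proof. by move=> A WA V' _ _; apply. Qed.

Lemma varietal_join_least U W V' : is_variety V' ->
  subclass U V' -> subclass W V' -> subclass (varietal_join U W) V'.
Proof. by move=> vV' UV WV A; apply. Qed.

Definition ca_hom (A B : closureAlgType) (f : A -> B) : Prop :=
  [/\ f \bot = \bot, f \top = \top,
      (forall a b, f (a `&` b) = f a `&` f b),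
      (forall a b, f (a `|` b) = f a `|` f b) &
      (forall a, f (~` a) = ~` f a) /\ (forall a, f (diamond a) = diamond (f a))].

Fixpoint tsubst (f : nat -> term) (t : term) : term :=
  match t with
  | TVar n => f n
  | TBot => TBot
  | TTop => TTop
  | TMeet s u => TMeet (tsubst f s) (tsubst f u)
  | TJoin s u => TJoin (tsubst f s) (tsubst f u)
  | TNeg s => TNeg (tsubst f s)
  | TDia s => TDia (tsubst f s)
  end.

Lemma eval_tsubst (A : closureAlgType) (v : nat -> A) f t :
  eval v (tsubst f t) = eval (fun n => eval v (f n)) t.
Proof. by elim: t => //= [s -> u ->|s -> u ->|s ->|s ->]. Qed.

Lemma eval_hom (A B : closureAlgType) (h : A -> B) (v : nat -> A) t :
  ca_hom h -> h (eval v t) = eval (h \o v) t.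
Proof.
case=> h0 h1 hI hU [hN hD].
by elim: t => //= [s <- u <-|s <- u <-|s <-|s <-].
Qed.

Lemma eval_free V (v : nat -> free_alg V) t :
  eval v t = fpi V (tsubst (fun n => frepr (v n)) t).
Proof.
elim: t => [n|||s IHs u IHu|s IHs u IHu|s IHs|s IHs] //=.
- by rewrite freprK.
- by rewrite IHs IHu -[LHS]/(fmeet _ _) fopE.
- by rewrite IHs IHu -[LHS]/(fjoin _ _) fopE.
- by rewrite IHs -[LHS]/(fneg _) fopE.
- by rewrite IHs -[LHS]/(fdia _) fopE.
Qed.

Lemma free_alg_mem V : is_variety V -> V (free_alg V).
Proof.
case=> E VE; apply/VE => -[s t] Ee v; rewrite /sat_eq /= !eval_free.
apply/fpiP => A VA w; rewrite /sat_eq /= !eval_tsubst.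
exact: ((VE A).1 VA _ Ee).
Qed.

Lemma free_alg_universal V (A : closureAlgType) (f : nat -> A) : V A ->
  exists h : free_alg V -> A,
    [/\ ca_hom h, (forall n, h (free_gen V n) = f n) &
        forall g : free_alg V -> A, ca_hom g ->
          (forall n, g (free_gen V n) = f n) -> g =1 h].
Proof.
move=> VA; exists (fun x => eval f (frepr x)); split.
- split; [exact: (frepr_eval f TBot VA) | exact: (frepr_eval f TTop VA) | | |].
  + by move=> a b; rewrite -[a `&` b]/(fmeet a b) frepr_eval.
  + by move=> a b; rewrite -[a `|` b]/(fjoin a b) frepr_eval.
  + split=> a; first by rewrite -[~` a]/(fneg a) frepr_eval.
    by rewrite -[diamond a]/(fdia a) frepr_eval.
- by move=> n; rewrite frepr_eval.
- move=> g hg gf x; rewrite -[x in LHS]freprK.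
  have -> : fpi V (frepr x) = eval (free_gen V) (frepr x).
    elim: (frepr x) => [n|||s IHs u IHu|s IHs u IHu|s IHs|s IHs] //=.
    - by rewrite -IHs -IHu -[RHS]/(fmeet _ _) fopE.
    - by rewrite -IHs -IHu -[RHS]/(fjoin _ _) fopE.
    - by rewrite -IHs -[RHS]/(fneg _) fopE.
    - by rewrite -IHs -[RHS]/(fdia _) fopE.
  rewrite eval_hom //; congr eval; apply/funext => n /=; exact: gf.
Qed.

(* Main.v *)
(* Modulo deduction, a quasi-identity p = 1 -> r = 1 holds in a variety iff
   []p <= r does.  A structurally complete variety satisfies the McKinsey law
   []<>x <= <>[]x: otherwise a relativization to an open element has an x with
   <>x = <>~x = 1, which no nontrivial free algebra has.  A monadic algebra with
   the McKinsey law is discrete, and the variety of discrete algebras is minimal;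
   so the join is not structurally complete.
   For the positive part, let q be active in U v W.
   - The term x \/ ([]<>x /\ ~<>[]x) is x in U and the clopen element <>x in W.
     Precomposing with it turns a solution of p in the free algebra of U into one
     in the free algebra of U v W, since equations of a nontrivial U hold under
     all clopen valuations.  Hence q is true in the free algebra of U, and holds
     in U.
   - As p is solvable, it has a Boolean solution d.  With a fresh y, the element
     o = []p /\ []<>y /\ ~<>[]y is 0 in U and clopen in W, so splicing the generic
     valuation on o with d off o solves p in U v W.  This gives
     []p /\ <>y /\ ~[]y <= r in W, and what escapes all gaps <>y /\ ~[]y is
     discrete, where the identities of a nontrivial U hold. *)
From HB Require Import structures.
From mathcomp Require Import all_boot all_order boolp.
Require Import Defs.

Set Implicit Arguments.
Unset Strict Implicit.
Unset Printing Implicit Defensive.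

Import Order.Theory.
Local Open Scope order_scope.

(** * Open and clopen elements of closure algebras *)

Definition is_open (A : closureAlgType) (o : A) : Prop :=
  diamond (~` o) = ~` o.

Definition clopen (A : closureAlgType) (o : A) : Prop :=
  diamond o = o /\ is_open o.

Section ClosureAlgebraTheory.
Variable A : closureAlgType.
Implicit Types a b o : A.

Lemma diamond_mono a b : a <= b -> diamond a <= diamond b.
Proof. by move/join_idPr=> <-; rewrite diamondU leUl. Qed.

Lemma diamond1 : diamond (\top : A) = \top.
Proof. by apply/le_anti; rewrite lex1 diamond_ge. Qed.

Lemma box1 : box (\top : A) = \top.
Proof. by rewrite /box compl1 diamond0 compl0. Qed.

Lemma box_le a : box a <= a.
Proof. by rewrite /box leCx diamond_ge. Qed.

Lemma box_compl a : box (~` a) = ~` diamond a.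
Proof. by rewrite /box complK. Qed.

Lemma open_box a : is_open (box a).
Proof. by rewrite /is_open /box complK diamondK. Qed.

Lemma openI a b : is_open a -> is_open b -> is_open (a `&` b).
Proof. by rewrite /is_open complI diamondU => -> ->. Qed.

Lemma meet_compl_mod a o : ~` (a `&` o) `&` o = ~` a `&` o.
Proof. by rewrite complI meetUl meetCx joinx0. Qed.

(** Split [a] along [o]: the part of [a] below the closed element [~] o[has its closure below]~[o]
    too, so it contributes nothing on [o]. *)
Lemma diamond_mod o a : is_open o -> diamond (a `&` o) `&` o = diamond a `&` o.
Proof.
move=> oo; apply/le_anti/andP; split; first by rewrite leI2 ?diamond_mono ?leIl.
have {1}-> : a = (a `&` o) `|` (a `&` ~` o) by rewrite -meetUr joinxC meetx1.
rewrite diamondU meetUl leUx lexx /= lexI leIr andbT.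
suff -> : diamond (a `&` ~` o) `&` o = \bot by rewrite le0x.
by apply/eqP; rewrite disj_leC -[X in _ <= X]oo diamond_mono // leIr.
Qed.

Lemma clopenC a : clopen a -> clopen (~` a).
Proof. by rewrite /clopen /is_open complK => -[]. Qed.

Lemma clopenU a b : clopen a -> clopen b -> clopen (a `|` b).
Proof.
move=> [a1 a2] [b1 b2]; split; first by rewrite diamondU a1 b1.
rewrite /is_open complU; apply/le_anti; rewrite diamond_ge andbT lexI.
by rewrite -{2}a2 -{3}b2 !diamond_mono ?leIl ?leIr.
Qed.

Lemma clopenI a b : clopen a -> clopen b -> clopen (a `&` b).
Proof.
by move=> /clopenC ca /clopenC cb; rewrite -[_ `&` _]complK complI;
   apply/clopenC/clopenU.
Qed.

Lemma clopen0 : clopen (\bot : A).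
Proof. by split; rewrite /is_open ?diamond0 // compl0 diamond1. Qed.

(** For open [o], agreement on [o] is a congruence; [diamond_mod] settles the case of [diamond]. *)
Lemma eval_mod (v w : nat -> A) o t : is_open o ->
  (forall n, v n `&` o = w n `&` o) -> eval v t `&` o = eval w t `&` o.
Proof.
move=> oo vw; elim: t => [n|||s IHs u IHu|s IHs u IHu|s IHs|s IHs] //=.
- by rewrite -[o]meetxx meetACA IHs IHu meetACA.
- by rewrite !meetUl IHs IHu.
- by rewrite -meet_compl_mod IHs meet_compl_mod.
- by rewrite -diamond_mod // IHs diamond_mod.
Qed.

End ClosureAlgebraTheory.

Section Monadic.
Variable A : closureAlgType.
Hypothesis monA : monadic A.

Lemma monadic_box (a : A) : clopen (box a).
Proof. by split; [exact: monA | exact: open_box]. Qed.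

Lemma monadic_diamond (a : A) : clopen (diamond a).
Proof. by rewrite -[diamond a]complK -box_compl; apply/clopenC/monadic_box. Qed.

End Monadic.

(** * Boolean and clopen valuations *)

Fixpoint beval (d : nat -> bool) (t : term) : bool :=
  match t with
  | TVar n => d n
  | TBot => false
  | TTop => true
  | TMeet s u => beval d s && beval d u
  | TJoin s u => beval d s || beval d u
  | TNeg s => ~~ beval d s
  | TDia s => beval d s
  end.

Definition of_bool (A : closureAlgType) (b : bool) : A :=
  if b then \top else \bot.

Lemma eval_bool (A : closureAlgType) (d : nat -> bool) t :
  eval (fun n => of_bool A (d n)) t = of_bool A (beval d t).
Proof.
elim: t => //= [s -> u ->|s -> u ->|s ->|s ->].
- by do 2!case: beval; rewrite /= ?meetx1 ?meetx0.
- by do 2!case: beval; rewrite /= ?joinx1 ?joinx0.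
- by case: beval; rewrite /= ?compl1 ?compl0.
- by case: beval; rewrite /= ?diamond1 ?diamond0.
Qed.

Fixpoint var_bound (t : term) : nat :=
  match t with
  | TVar n => n.+1
  | TBot | TTop => 0
  | TMeet s u | TJoin s u => maxn (var_bound s) (var_bound u)
  | TNeg s | TDia s => var_bound s
  end.

Lemma eq_eval (A : closureAlgType) (v w : nat -> A) t :
  (forall n, (n < var_bound t)%N -> v n = w n) -> eval v t = eval w t.
Proof.
elim: t => //= [n|s IHs u IHu|s IHs u IHu|s IHs|s IHs] H; first exact: H.
- by rewrite IHs ?IHu // => n ltn; apply: H; rewrite leq_max ltn ?orbT.
- by rewrite IHs ?IHu // => n ltn; apply: H; rewrite leq_max ltn ?orbT.
- by rewrite IHs.
- by rewrite IHs.
Qed.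

(* Shannon expansion: a clopen value [v k] may be replaced by [\top] modulo
   [v k] and by [\bot] modulo its complement. *)
Lemma eval_tautology (A : closureAlgType) (v : nat -> A) t :
  (forall d, beval d t) -> (forall n, clopen (v n)) -> eval v t = \top.
Proof.
move=> taut cv.
(* Induction on the number [k] of variables that keep their clopen values; the others receive
   Boolean constants. *)
suff H k (d : nat -> bool) :
    eval (fun n => if (n < k)%N then v n else of_bool A (d n)) t = \top.
  by rewrite -(H (var_bound t) (fun=> true)); apply: eq_eval => n ->.
elim: k d => [|k IHk] d; first by rewrite (eval_bool A d) taut.
have step b o : is_open o -> v k `&` o = of_bool A b `&` o ->
    eval (fun n => if (n < k.+1)%N then v n else of_bool A (d n)) t `&` o = o.
  move=> oo vo; rewrite -[RHS]meet1x -(IHk (fun n => if n == k then b else d n)).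
  apply: eval_mod => // n; rewrite ltnS leq_eqVlt.
  by case: (eqVneq n k) => [->|] //=; rewrite ltnn.
rewrite -[LHS]meetx1 -(joinxC (v k)) meetUr.
rewrite (step true) ?meetxx ?meet1x //; last by case: (cv k).
rewrite (step false) ?meetxC ?meet0x //; by case: (clopenC (cv k)).
Qed.

(** * Relativization to an open element *)

(** The proof of openness is an argument of the type so that the closure algebra structure, which
    rests on it, can be inferred. *)
Definition relativization (A : closureAlgType) (o : A) of is_open o : Type :=
  {x : A | x <= o}.

Section Relativization.
Variables (A : closureAlgType) (o : A) (oo : is_open o).
Local Notation B := (relativization oo).

HB.instance Definition _ := Choice.on B.

Definition restrict (a : A) : B := exist _ (a `&` o) (leIr o a).

Lemma restrict_eq a b : (restrict a = restrict b) <-> (a `&` o = b `&` o).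
Proof. by split=> [/(congr1 val)|ab] //; apply/val_inj. Qed.

Lemma restrict_surj (x : B) : exists a, restrict a = x.
Proof. by exists (val x); apply/val_inj/meet_idPl/(valP x). Qed.

(** As the operations commute with [restrict], this reduces each law of [B] to the same law of
    [A]. *)
Lemma restrict_ind (P : B -> Prop) : (forall a, P (restrict a)) -> forall x, P x.
Proof. by move=> H x; have [a <-] := restrict_surj x. Qed.

Definition rmeet (x y : B) := restrict (val x `&` val y).
Definition rjoin (x y : B) := restrict (val x `|` val y).
Definition rneg (x : B) := restrict (~` val x).
Definition rdia (x : B) := restrict (diamond (val x)).
Definition rle (x y : B) : bool := rmeet x y == x.
Definition rlt (x y : B) : bool := (y != x) && rle x y.

Lemma rmeetE a b : rmeet (restrict a) (restrict b) = restrict (a `&` b).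
Proof. by apply/restrict_eq; rewrite meetACA meetxx -meetA meetxx. Qed.
Lemma rjoinE a b : rjoin (restrict a) (restrict b) = restrict (a `|` b).
Proof. by apply/restrict_eq; rewrite -meetUl -meetA meetxx. Qed.
Lemma rnegE a : rneg (restrict a) = restrict (~` a).
Proof. by apply/restrict_eq; rewrite meet_compl_mod. Qed.
Lemma rdiaE a : rdia (restrict a) = restrict (diamond a).
Proof. by apply/restrict_eq; rewrite diamond_mod. Qed.

Definition ropE := (rmeetE, rjoinE, rnegE, rdiaE).

Fact rmeetC : commutative rmeet.
Proof. by move=> x y; rewrite /rmeet meetC. Qed.
Fact rjoinC : commutative rjoin.
Proof. by move=> x y; rewrite /rjoin joinC. Qed.
Fact rmeetA : associative rmeet.
Proof.
elim/restrict_ind => a; elim/restrict_ind => b; elim/restrict_ind => c.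
by rewrite !ropE meetA.
Qed.
Fact rjoinA : associative rjoin.
Proof.
elim/restrict_ind => a; elim/restrict_ind => b; elim/restrict_ind => c.
by rewrite !ropE joinA.
Qed.
Fact rjoinKI (y x : B) : rmeet x (rjoin x y) = x.
Proof.
by elim/restrict_ind: x => a; elim/restrict_ind: y => b; rewrite !ropE joinKI.
Qed.
Fact rmeetKU (y x : B) : rjoin x (rmeet x y) = x.
Proof.
by elim/restrict_ind: x => a; elim/restrict_ind: y => b; rewrite !ropE meetKU.
Qed.
Fact rmeetUl : left_distributive rmeet rjoin.
Proof.
elim/restrict_ind => a; elim/restrict_ind => b; elim/restrict_ind => c.
by rewrite !ropE meetUl.
Qed.
Fact rmeetxx : idempotent_op rmeet.
Proof. by elim/restrict_ind => a; rewrite ropE meetxx. Qed.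
Fact rle_def x y : rle x y = (rmeet x y == x). Proof. by []. Qed.
Fact rlt_def x y : rlt x y = (y != x) && rle x y. Proof. by []. Qed.

HB.instance Definition _ := @Order.isMeetJoinDistrLattice.Build
  ca_display B rle rlt rmeet rjoin rle_def rlt_def rmeetC rjoinC
  rmeetA rjoinA rjoinKI rmeetKU rmeetUl rmeetxx.

Fact rle0x (x : B) : restrict \bot <= x.
Proof.
by apply/eqP; elim/restrict_ind: x => a; rewrite -[LHS]/(rmeet _ _) ropE meet0x.
Qed.
Fact rlex1 (x : B) : x <= restrict \top.
Proof.
by apply/eqP; elim/restrict_ind: x => a; rewrite -[LHS]/(rmeet _ _) ropE meetx1.
Qed.

HB.instance Definition _ := @Order.hasBottom.Build ca_display B _ rle0x.
HB.instance Definition _ := @Order.hasTop.Build ca_display B _ rlex1.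

Fact rjoinxC (x : B) : x `|` rneg x = \top.
Proof.
by elim/restrict_ind: x => a; rewrite -[LHS]/(rjoin _ _) !ropE joinxC.
Qed.
Fact rmeetxC (x : B) : x `&` rneg x = \bot.
Proof.
by elim/restrict_ind: x => a; rewrite -[LHS]/(rmeet _ _) !ropE meetxC.
Qed.

HB.instance Definition _ := @Order.TBDistrLattice_hasComplement.Build
  ca_display B rneg rjoinxC rmeetxC.

Fact rdia0 : rdia \bot = \bot.
Proof. by rewrite -[\bot]/(restrict \bot) ropE diamond0. Qed.
Fact rdiaU (x y : B) : rdia (x `|` y) = rdia x `|` rdia y.
Proof.
elim/restrict_ind: x => a; elim/restrict_ind: y => b.
by rewrite -[RHS]/(rjoin _ _) -[_ `|` _]/(rjoin _ _) !ropE diamondU.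
Qed.
Fact rdia_ge (x : B) : x <= rdia x.
Proof.
elim/restrict_ind: x => a; apply/eqP; rewrite -[LHS]/(rmeet _ _) !ropE.
by rewrite (meet_idPl (diamond_ge a)).
Qed.
Fact rdiaK (x : B) : rdia (rdia x) = rdia x.
Proof. by elim/restrict_ind: x => a; rewrite !ropE diamondK. Qed.

HB.instance Definition _ :=
  isClosureAlgebra.Build B rdia0 rdiaU rdia_ge rdiaK.

Lemma restrict_hom : ca_hom (restrict : A -> B).
Proof.
split=> //; [| | split] => *.
- by rewrite -[RHS]/(rmeet _ _) ropE.
- by rewrite -[RHS]/(rjoin _ _) ropE.
- by rewrite -[RHS]/(rneg _) ropE.
- by rewrite -[RHS]/(rdia _) ropE.
Qed.

Lemma restrict_eq1 a : (restrict a = \top) <-> (o <= a).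
Proof.
by rewrite (restrict_eq a \top) meet1x; split=> [/meet_idPr|/meet_idPr].
Qed.

End Relativization.

Lemma variety_image V (A B : closureAlgType) (f : A -> B) :
  is_variety V -> ca_hom f -> (forall y, exists x, f x = y) -> V A -> V B.
Proof.
case=> E VE homf surjf VA; apply/VE => e Ee v.
have [w wE] := choice (fun n => surjf (v n)).
have -> : v = f \o w by apply/funext => n /=.
by rewrite /sat_eq -!eval_hom // ((VE A).1 VA e Ee).
Qed.

Lemma variety_relativization V (A : closureAlgType) (o : A) (oo : is_open o) :
  is_variety V -> V A -> V (relativization oo).
Proof.
by move=> varV; apply: (variety_image varV (restrict_hom oo) (@restrict_surj _ _ oo)).
Qed.

(** * Quasi-identities as pairs of terms, and the deduction theorem *)

Definition TBox (t : term) : term := TNeg (TDia (TNeg t)).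
Definition TImp (s t : term) : term := TJoin (TNeg s) t.
Definition TEqv (s t : term) : term := TMeet (TImp s t) (TImp t s).

Lemma le_impE (A : closureAlgType) (a b : A) : (~` a `|` b = \top) <-> (a <= b).
Proof.
split=> [ab|ab]; last by apply/le_anti; rewrite lex1 -(joinCx a) leU2.
by rewrite -[a]meetx1 -ab meetUr meetxC join0x leIr.
Qed.

Lemma eval_TImp (A : closureAlgType) (v : nat -> A) s t :
  eval v (TImp s t) = \top <-> eval v s <= eval v t.
Proof. exact: le_impE. Qed.

Lemma eval_TEqv (A : closureAlgType) (v : nat -> A) s t :
  eval v (TEqv s t) = \top <-> eval v s = eval v t.
Proof.
split=> [/eqP|st]; last first.
  by rewrite /= st joinCx meetxx.
rewrite /= -le1x lexI !le1x => /andP[/eqP/le_impE st /eqP/le_impE ts].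
by apply/le_anti/andP.
Qed.

Definition premise_term (phi : seq equation) : term :=
  foldr (fun e t => TMeet (TEqv e.1 e.2) t) TTop phi.

Lemma sat_premise (A : closureAlgType) (v : nat -> A) phi :
  sat_conj v phi <-> eval v (premise_term phi) = \top.
Proof.
elim: phi => [|e phi IH] //; rewrite [sat_conj _ _]/= IH [premise_term _]/=.
rewrite /sat_eq -eval_TEqv; set s := TEqv _ _; split=> /= [[-> ->]|/eqP].
  by rewrite meetxx.
by rewrite -le1x lexI !le1x => /andP[/eqP ? /eqP ?].
Qed.

Definition conclusion_term (q : quasi_identity) : term :=
  TEqv (conclusion q).1 (conclusion q).2.

Lemma true_qidE (A : closureAlgType) q :
  true_qid A q <-> forall v : nat -> A,
    eval v (premise_term (premise q)) = \top ->
    eval v (conclusion_term q) = \top.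
Proof.
by split=> H v /sat_premise /H /eval_TEqv.
Qed.

Definition valid (V : algebra_class) (t : term) : Prop :=
  forall A, V A -> forall v : nat -> A, eval v t = \top.

(** Relativize to the interior of the value of [p]. There [p] takes the value [\top], hence so does
    [r], which means that the value of [r] lies above that interior. *)
Lemma deduction V p r : is_variety V ->
  (forall A, V A -> forall v : nat -> A, eval v p = \top -> eval v r = \top) ->
  valid V (TImp (TBox p) r).
Proof.
move=> varV H A VA v; apply/eval_TImp; set o := eval v (TBox p).
have oo : is_open o by exact: open_box.
apply/(restrict_eq1 oo); rewrite (eval_hom _ _ (restrict_hom oo)).
apply: H (variety_relativization oo varV VA) _ _.
by rewrite -eval_hom; [apply/restrict_eq1/box_le | exact: restrict_hom].
Qed.

Lemma valid_qid V q :
  valid V (TImp (TBox (premise_term (premise q))) (conclusion_term q)) ->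
  forall A, V A -> true_qid A q.
Proof.
move=> Vq A VA; apply/true_qidE => v vp.
have /eval_TImp := Vq A VA v.
by rewrite [eval v (TBox _)]/= -/(box _) vp box1 le1x => /eqP.
Qed.

(** * Truth in free algebras as validity of substitution instances *)

Lemma eval_fpi V (f : nat -> term) t :
  eval (fun n => fpi V (f n)) t = fpi V (tsubst f t).
Proof.
rewrite eval_free; apply/fpiP => A VA v; rewrite /sat_eq /= !eval_tsubst.
by congr eval; apply/funext => n; rewrite frepr_eval.
Qed.

Lemma eval_fpi_top V (f : nat -> term) t :
  eval (fun n => fpi V (f n)) t = \top <-> valid V (tsubst f t).
Proof. by rewrite eval_fpi; apply: (fpiP V _ TTop). Qed.

Lemma free_valuation V (v : nat -> free_alg V) :
  v = fun n => fpi V (frepr (v n)).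
Proof. by apply/funext => n; rewrite freprK. Qed.

Lemma true_qid_free V q :
  true_qid (free_alg V) q <-> forall f : nat -> term,
    valid V (tsubst f (premise_term (premise q))) ->
    valid V (tsubst f (conclusion_term q)).
Proof.
rewrite true_qidE; split=> H f.
  by move=> /eval_fpi_top /H /eval_fpi_top.
by rewrite (free_valuation f) => /eval_fpi_top /H /eval_fpi_top.
Qed.

Lemma sat_premise_free V phi :
  ~ (forall v : nat -> free_alg V, ~ sat_conj v phi) ->
  exists f : nat -> term, valid V (tsubst f (premise_term phi)).
Proof.
move/existsNP=> [v /contrapT]; rewrite (free_valuation v).
by move=> /sat_premise /eval_fpi_top; exists (fun n => frepr (v n)).
Qed.

Lemma trivial_bot_top (A : closureAlgType) :
  (\bot : A) = \top -> trivial_variety A.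
Proof. by move=> A01 x y; rewrite -[x]meetx1 -[y]meetx1 -A01 !meetx0. Qed.

Lemma class_trivial_or V :
  subclass V trivial_variety \/ exists2 A, V A & (\bot : A) <> \top.
Proof.
have [|ntV] := pselect (exists2 A, V A & (\bot : A) <> \top); first by right.
by left=> A VA; apply: trivial_bot_top; apply: contrapT => A01; apply: ntV; exists A.
Qed.

(** The constants of [A] form a copy of the two-element algebra, so an identity of [V] holds under
    Boolean valuations. *)
Lemma valid_tautology V (A : closureAlgType) t :
  V A -> (\bot : A) <> \top -> valid V t -> forall d, beval d t.
Proof.
move=> VA A01 Vt d; have := Vt A VA (fun n => of_bool A (d n)).
by rewrite eval_bool; case: beval.
Qed.

Lemma valid_trivial V t : subclass V trivial_variety -> valid V t.
Proof. by move=> trV A VA v; apply: trV. Qed.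

(** * The McKinsey law and minimality *)

Lemma compl_diamond_box (A : closureAlgType) (a : A) :
  ~` diamond (box a) = box (diamond (~` a)).
Proof. by []. Qed.

(* Substituting constants shows that <>x /\ <>~x = 1 has no solution in a
   nontrivial free algebra, while a failure of []<>a <= <>[]a gives one in a
   nontrivial relativization. *)
Lemma structurally_complete_mckinsey V : is_variety V ->
  structurally_complete V ->
  forall A, V A -> forall a : A, box (diamond a) <= diamond (box a).
Proof.
move=> varV scV A VA a.
pose q := QuasiIdentity
  [:: (TMeet (TDia (TVar 0)) (TDia (TNeg (TVar 0))), TTop)] (TBot, TTop).
have Fq : true_qid (free_alg V) q.
  apply/true_qid_free => f; have [trV _|[B VB B01]] := class_trivial_or V.
    exact: valid_trivial.
  move=> /(valid_tautology VB B01)/(_ (fun=> false)) /=.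
  by case: beval.
(* By [compl_diamond_box], [o] is the part of [box (diamond a)] outside [diamond (box a)]. *)
set o := box (diamond a) `&` box (diamond (~` a)).
have oo : is_open o by apply: openI; exact: open_box.
have oa : o <= diamond a by apply: leIxl; exact: box_le.
have oNa : o <= diamond (~` a) by apply: leIxr; exact: box_le.
have [_ _ hI _ [hN hD]] := restrict_hom oo.
have : (\bot : relativization oo) = \top.
  apply: (scV q Fq _ (variety_relativization oo varV VA) (fun=> restrict oo a)).
  split=> //; rewrite /sat_eq /= -hN -!hD -hI; apply/restrict_eq1.
  by rewrite lexI oa oNa.
move/restrict_eq1; rewrite -[box (diamond a)]meetx1.
rewrite lex0 => /eqP o0.
by rewrite meetx1 -[diamond (box a)]complK -disj_leC compl_diamond_box -/o o0.
Qed.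

(** Here [diamond a] is open and [box a] is closed, so the McKinsey law collapses to
    [diamond a <= box a]. *)
Lemma monadic_mckinsey (A : closureAlgType) : monadic A ->
  (forall a : A, box (diamond a) <= diamond (box a)) -> forall a : A, clopen a.
Proof.
move=> monA mcA.
have dE (a : A) : diamond a = a.
  apply/le_anti; rewrite diamond_ge andbT; apply: le_trans (box_le a).
  rewrite -monA; apply: le_trans (mcA a).
  by have [_ dd] := monadic_diamond monA a; rewrite /box dd complK.
by move=> a; split; rewrite /is_open !dE.
Qed.

(** Identities of a nontrivial subvariety are Boolean tautologies, which hold in every discrete
    algebra; such a subvariety is therefore not proper. *)
Lemma discrete_minimal (W : algebra_class) :
  (forall A, W A -> forall a : A, clopen a) -> minimal_variety W.
Proof.
move=> dW V' [E V'E] [_ nWV'] A; split; last first.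
  by move=> trA; apply/V'E => e _ v; apply: trA.
have [trV'|[B V'B B01]] := class_trivial_or V'; first exact: trV'.
case: nWV' => C WC; apply/V'E => e Ee v; apply/eval_TEqv.
apply: eval_tautology => [d|n]; last exact: dW.
apply: (valid_tautology V'B B01) => D V'D w; apply/eval_TEqv.
exact: ((V'E D).1 V'D e Ee).
Qed.

(** * Transfer of admissibility from the join to [U] *)

Lemma valid_join U W t :
  valid U t -> valid W t -> valid (varietal_join U W) t.
Proof.
(* The models of a single identity form a variety; [M] contains [U] and [W], hence their join. *)
move=> Ut Wt; pose M B := forall e, e = (t, TTop) -> true_eq B e.
suff VM : subclass (varietal_join U W) M by move=> A /VM/(_ _ erefl); exact.
apply: varietal_join_least; first by exists (fun e => e = (t, TTop)) => B; exact: iff_refl.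
- by move=> B UB e -> v; apply: Ut.
- by move=> B WB e -> v; apply: Wt.
Qed.

Lemma valid_join_l U W t : valid (varietal_join U W) t -> valid U t.
Proof. by move=> Vt A UA; apply: Vt; apply: varietal_join_subl. Qed.

Lemma tsubst_comp f g t :
  tsubst g (tsubst f t) = tsubst (fun n => tsubst g (f n)) t.
Proof. by elim: t => //= [s -> u ->|s -> u ->|s ->|s ->]. Qed.

Lemma beval_tsubst d f t :
  beval d (tsubst f t) = beval (fun n => beval d (f n)) t.
Proof. by elim: t => //= [s -> u ->|s -> u ->|s ->]. Qed.

(** The failure of the McKinsey law at a variable; in a monadic algebra it is the boundary of the
    value. *)
Definition TGap (n : nat) : term :=
  TMeet (TBox (TDia (TVar n))) (TNeg (TDia (TBox (TVar n)))).

Lemma eval_TGap_mckinsey (A : closureAlgType) (v : nat -> A) n :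
  (forall a : A, box (diamond a) <= diamond (box a)) -> eval v (TGap n) = \bot.
Proof. by move=> mcA; apply/eqP; rewrite disj_leC complK; exact: mcA. Qed.

Lemma eval_TGap_monadic (A : closureAlgType) (v : nat -> A) n : monadic A ->
  eval v (TGap n) = diamond (v n) `&` ~` box (v n).
Proof.
move=> monA; rewrite -[LHS]/(box (diamond (v n)) `&` ~` diamond (box (v n))).
rewrite monA; congr (_ `&` _).
by have [_ dd] := monadic_diamond monA (v n); rewrite /box dd complK.
Qed.

(* Acts as the identity on McKinsey algebras and as [diamond] on monadic ones. *)
Definition saturate (n : nat) : term := TJoin (TVar n) (TGap n).

Lemma eval_saturate_mckinsey (A : closureAlgType) (v : nat -> A) n :
  (forall a : A, box (diamond a) <= diamond (box a)) ->
  eval v (saturate n) = v n.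
Proof. move=> mcA; rewrite -[LHS]/(v n `|` eval v (TGap n)).
by rewrite eval_TGap_mckinsey ?joinx0. Qed.

Lemma eval_saturate_monadic (A : closureAlgType) (v : nat -> A) n :
  monadic A -> eval v (saturate n) = diamond (v n).
Proof.
move=> monA; rewrite -[LHS]/(v n `|` eval v (TGap n)).
rewrite eval_TGap_monadic // joinIr.
rewrite (join_idPr (diamond_ge _)) joinC; move/le_impE: (box_le (v n)) => ->.
by rewrite meetx1.
Qed.

Lemma admissible_left (U W : algebra_class) q : subclass W monadic ->
  (forall A, U A -> forall a : A, box (diamond a) <= diamond (box a)) ->
  true_qid (free_alg (varietal_join U W)) q -> true_qid (free_alg U) q.
Proof.
move=> monW mcU /true_qid_free Vq; apply/true_qid_free => f.
have [trU _|[A UA A01]] := class_trivial_or U; first exact: valid_trivial.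
have idU t : valid U (tsubst saturate t) <-> valid U t.
  split=> Ut B UB v; have := Ut B UB v; rewrite eval_tsubst;
    by under eq_fun do rewrite (eval_saturate_mckinsey _ _ (mcU B UB)).
move=> Up; have {Vq} := Vq (fun n => tsubst saturate (f n)).
rewrite -!tsubst_comp => Vq; apply/idU; apply: (@valid_join_l U W); apply/Vq/valid_join.
  exact/idU.
(* Being valid in the nontrivial [U], the term is a tautology, and saturated variables are clopen in
   [B]. *)
move=> B WB v; rewrite eval_tsubst; apply: eval_tautology.
  exact: valid_tautology UA A01 Up.
move=> n; rewrite (eval_saturate_monadic _ _ (monW B WB)).
exact/monadic_diamond/monW.
Qed.

(** * Splicing and transfer to [W] *)

Definition shift (t : term) : term := tsubst (fun n => TVar n.+1) t.

(** The generic variables start at index 1, leaving variable 0 free to serve as the fresh variable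
    inside [o]. *)
Definition splice (o : term) (d : nat -> bool) (n : nat) : term :=
  TJoin (TMeet (TVar n.+1) o) (TMeet (if d n then TTop else TBot) (TNeg o)).

Section Splice.
Variables (A : closureAlgType) (v : nat -> A) (o : term) (d : nat -> bool).
Hypothesis co : clopen (eval v o).

Lemma eval_splice_at t :
  eval v (tsubst (splice o d) t) `&` eval v o
    = eval (fun n => v n.+1) t `&` eval v o.
Proof.
rewrite eval_tsubst; apply: eval_mod => [|n] /=; first by case: co.
by rewrite meetUl -!meetA meetxx meetCx meetx0 joinx0.
Qed.

Lemma eval_splice_off t :
  eval v (tsubst (splice o d) t) `&` ~` eval v o
    = of_bool A (beval d t) `&` ~` eval v o.
Proof.
rewrite eval_tsubst -eval_bool.
apply: eval_mod => [|n] /=; first by case: (clopenC co).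
rewrite meetUl -!meetA meetxC meetx0 join0x meetxx.
by case: (d n).
Qed.

Lemma eval_splice_top t : beval d t ->
  eval v o <= eval (fun n => v n.+1) t -> eval v (tsubst (splice o d) t) = \top.
Proof.
move=> dt ot; rewrite -[LHS]meetx1 -(joinxC (eval v o)) meetUr.
by rewrite eval_splice_at eval_splice_off dt meet1x (meet_idPr ot).
Qed.

End Splice.

(* On the clopen part [o] the generic valuation solves [p]; off it the Boolean
   solution [d] does. *)
Lemma admissible_splice V p r o d :
  (forall f, valid V (tsubst f p) -> valid V (tsubst f r)) -> beval d p ->
  valid V (tsubst (splice o d) p) ->
  forall A, V A -> forall v : nat -> A, clopen (eval v o) ->
  eval v o <= eval (fun n => v n.+1) r.
Proof.
move=> Vpr dp Vp A VA v co.
have := eval_splice_at d co r; rewrite (Vpr _ Vp) // meet1x => ->.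
exact: leIl.
Qed.

(** Let [c] be the closure of the complement of the value of [t]. It misses every gap, since gaps
    are clopen, so on [c] each [v n] agrees with the clopen [diamond (v n)]. The tautology [t] is
    then [\top] on [c], which forces the complement to vanish. *)
Lemma monadic_valid_of_gap (A : closureAlgType) (v : nat -> A) t : monadic A ->
  (forall d, beval d t) ->
  (forall n, diamond (v n) `&` ~` box (v n) <= eval v t) -> eval v t = \top.
Proof.
move=> monA taut gap; set e := ~` eval v t.
have [dc oc] := monadic_diamond monA e; set c := diamond e in dc oc.
have cgap n : c <= ~` (diamond (v n) `&` ~` box (v n)).
  have /clopenC[<- _] : clopen (diamond (v n) `&` ~` box (v n)).
    apply: clopenI; first exact: monadic_diamond.
    exact/clopenC/monadic_box.
  by apply: diamond_mono; rewrite leC.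
have vc n : v n `&` c = diamond (v n) `&` c.
  apply/le_anti; rewrite leI2 ?diamond_ge //= lexI leIr andbT.
  apply: le_trans (box_le _).
  apply: (le_trans (leI2 (lexx _) (cgap n))).
  by rewrite complI complK meetUr meetxC join0x leIr.
have := eval_mod t oc vc.
rewrite (eval_tautology (v := fun n => diamond (v n)) taut) => [|n]; last exact: monadic_diamond.
rewrite meet1x => /meet_idPr ct; rewrite -[LHS]complK -/e.
suff -> : e = \bot by rewrite compl0.
by apply/eqP; rewrite -[e]meetxx disj_leC [~` e]complK (le_trans (diamond_ge e)).
Qed.

Lemma valid_right (U W : algebra_class) p r d : subclass W monadic ->
  (forall A, U A -> forall a : A, box (diamond a) <= diamond (box a)) ->
  (forall f, valid (varietal_join U W) (tsubst f p) ->
             valid (varietal_join U W) (tsubst f r)) ->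
  beval d p -> valid U (TImp (TBox p) r) -> valid W (TImp (TBox p) r).
Proof.
move=> monW mcU Vpr dp Upr A WA v.
have VA := @varietal_join_subr U W A WA.
have shiftE (B : closureAlgType) (w : nat -> B) :
    eval w (shift (TBox p)) = box (eval (fun n => w n.+1) p).
  by rewrite eval_tsubst.
have [trU|[B UB B01]] := class_trivial_or U.
  (* For trivial [U] only [W] constrains the splice, so no gap is required. The valuation [w] undoes
     the shift; its value at 0 is a filler. *)
  pose o := shift (TBox p); pose w n := v n.-1.
  apply/eval_TImp; rewrite -[eval v (TBox p)]/(box _) -(shiftE A w).
  apply: (admissible_splice (V := varietal_join U W) Vpr dp) => //.
    apply: valid_join => [|B WB u]; first exact: valid_trivial.
    apply: eval_splice_top; rewrite ?shiftE ?box_le //.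
    exact/monadic_box/monW.
  by rewrite shiftE; exact/monadic_box/monW.
pose o := TMeet (shift (TBox p)) (TGap 0).
have co (B' : closureAlgType) (u : nat -> B') : W B' -> clopen (eval u o).
  move=> WB'; rewrite -[eval u o]/(eval u (shift (TBox p)) `&` eval u (TGap 0)).
  have monB' := monW B' WB'; apply: clopenI.
    by rewrite [X in clopen X]shiftE; apply: monadic_box.
  rewrite [X in clopen X]eval_TGap_monadic //; apply: clopenI.
    exact: monadic_diamond.
  exact/clopenC/monadic_box.
have Vo : valid (varietal_join U W) (tsubst (splice o d) p).
  (* In [U] the gap vanishes and only [d] remains; in [W], [o] is clopen and lies below the shifted
     [p]. *)
  apply: valid_join => C KC u.
    have o0 : eval u o = \bot.
      rewrite -[eval u o]/(eval u (shift (TBox p)) `&` eval u (TGap 0)) eval_TGap_mckinsey ?meetx0 //.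
      exact: mcU.
    by apply: eval_splice_top; rewrite // o0 ?le0x //; exact: clopen0.
  apply: eval_splice_top => //; first exact: co.
  rewrite -[eval u o]/(eval u (shift (TBox p)) `&` eval u (TGap 0)).
  by apply: leIxl; rewrite shiftE box_le.
apply: monadic_valid_of_gap; first exact: monW.
  exact: valid_tautology UB B01 Upr.
(* Giving the fresh variable the value [v n] bounds the gap of [v n]. *)
move=> n; pose w m := if m is m'.+1 then v m' else v n.
have := admissible_splice Vpr dp Vo VA (co A w WA).
rewrite -[eval w o]/(eval w (shift (TBox p)) `&` eval w (TGap 0)) shiftE eval_TGap_monadic; last first.
  exact: monW.
rewrite [w 0]/= => le_r.
rewrite [eval v _]/= -/(box (eval v p)).
(* Off [box (eval v p)] the implication holds outright; on it [le_r] applies. *)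
rewrite -[_ `&` _]meet1x -(joinCx (box (eval v p))) meetUl leU2 //.
exact: leIl.
Qed.

Theorem theorem8p7 (U W : algebra_class)
    (varU : is_variety U) (scU : structurally_complete U)
    (varW : is_variety W) (monW : subclass W monadic)
    (nminW : ~ minimal_variety W) :
  almost_structurally_complete (varietal_join U W) /\
  ~ structurally_complete (varietal_join U W).
Proof.
have varV := varietal_join_variety U W.
have mcU := structurally_complete_mckinsey varU scU.
split=> [q [Fq /sat_premise_free[f0 Vf0]]|scV]; last first.
  apply: nminW; apply: discrete_minimal => A WA.
  apply: monadic_mckinsey (monW A WA) _.
  by apply: (structurally_complete_mckinsey varV scV); apply: varietal_join_subr.
apply: valid_qid.
have [trV|[B VB B01]] := class_trivial_or (varietal_join U W).
  exact: valid_trivial.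
have Uq : valid U (TImp (TBox (premise_term (premise q))) (conclusion_term q)).
  apply: (deduction varU) => A UA; apply/true_qidE.
  exact: (scU q (admissible_left monW mcU Fq)).
apply: valid_join => //; move/true_qid_free: Fq => Vq.
(* Any Boolean valuation of the solution [f0] yields a Boolean solution of the premise; here all
   variables are true. *)
apply: (valid_right (d := fun n => beval (fun=> true) (f0 n)) monW mcU Vq) => //.
by rewrite -beval_tsubst; apply: valid_tautology VB B01 Vf0 _.
Qed.
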